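(* Let $(X,d,\mu)$ be a geometrically doubling metric measure space, $1<p\le q<\infty$, $\beta\in(1,\infty)$ and $k\in(1,\infty)$. Then there exists a positive constant $C$ such that, for all $f\in\mathcal{M}_p^{q,(k)}(X)$, $$\left\|M_0^{(\beta)}f\right\|_{\mathcal{M}_p^{q,(k)}(X)}\le C\|f\|_{\mathcal{M}_p^{q,(k)}(X)}.$$
   Context: A metric space $(X,d)$ is geometrically doubling if there is $N_0\in\mathbb{N}$ such that any given ball contains no more than $N_0$ points at (mutual) distance exceeding half its radius. A geometrically doubling metric measure space $(X,d,\mu)$ is a geometrically doubling metric space with a non-negative Radon measure $\mu$; as throughout the paper, $\mu$ is a non-trivial Borel regular measure, finite on bounded sets and positive on (non-empty) open sets. For $k\in(0,\infty)$ and $1\le p\le q<\infty$, the modified Morrey space $\mathcal{M}_p^{q,(k)}(X)$ is the set of $f\in L^p_{\mathrm{loc}}(X)$ with $$\|f\|_{\mathcal{M}_p^{q,(k)}(X)}:=\sup_{B(x,r)\subset X}[\mu(B(x,kr))]^{1/q-1/p}\left[\int_{B(x,r)}|f(y)|^p\,d\mu(y)\right]^{1/p}<\infty,$$ the supremum over all balls $B(x,r)$ with $x\in X$, $r\in(0,\infty)$. For $\beta\in[1,\infty)$, the modified maximal operator $M_0^{(\beta)}$ is defined for $f\in L^1_{\mathrm{loc}}(X)$ and $x\in X$ by $$M_0^{(\beta)}f(x):=\sup_{r>0}\frac{1}{\mu(B(x,\beta r))}\int_{B(x,r)}|f(y)|\,d\mu(y).$$ *)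

(* Defs.v *)
From HB Require Import structures.
From mathcomp Require Import all_boot all_order all_algebra.
From mathcomp Require Import all_classical all_reals all_analysis.
From mathcomp Require Import measurable_realfun.

Set Implicit Arguments.
Unset Strict Implicit.
Unset Printing Implicit Defensive.

Import Order.TTheory GRing.Theory Num.Theory.

Local Open Scope classical_set_scope.
Local Open Scope ring_scope.

(* The library puts the Caratheodory sigma-algebra only on pointed types. As
   a space carrying a non-trivial measure is non-empty, the distinguished
   point is no restriction. *)
#[short(type="pmetricType")]
HB.structure Definition PointedMetric (K : numDomainType) :=
  {M of Pointed M & Metric K M}.

Section metric_measure_space.
Context {R : realType} (X : pmetricType R).

(* [ball x r] is the open ball [set y | mdist x y < r]. *)
Definition geometrically_doubling :=
  exists N0 : nat, forall (x : X) (r : R) (A : set X), 0 < r ->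
    A `<=` ball x r ->
    (forall y z, A y -> A z -> y <> z -> r / 2 < mdist y z) ->
    (A #<= `I_N0)%card.

Definition bounded_subset (A : set X) := exists (x : X) (r : R), A `<=` ball x r.

Definition borel_sets : set (set X) := <<s @open X >>.

Local Open Scope ereal_scope.

(* As is usual in analysis on metric spaces, a "measure" is defined on all
   subsets, i.e. it is an outer measure, and its measurable sets are the
   Caratheodory measurable ones. *)
Implicit Type mu : {outer_measure set X -> \bar R}.

Definition borel_regular mu :=
  borel_sets `<=` mu.-caratheodory /\
  forall A, exists B, [/\ borel_sets B, A `<=` B & mu B = mu A].

Definition radon_measure mu :=
  [/\ borel_sets `<=` mu.-caratheodory,
      forall K, compact K -> mu K < +oo,
      forall U, open U ->
        mu U = ereal_sup [set mu K | K in [set K | compact K /\ K `<=` U]] &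
      forall A,
        mu A = ereal_inf [set mu U | U in [set U | open U /\ A `<=` U]]].

Record metric_measure mu : Prop := MetricMeasure {
  mm_radon : radon_measure mu ;
  mm_borel_regular : borel_regular mu ;
  mm_nontrivial : mu setT != 0 ;
  mm_finite_bounded : forall A, bounded_subset A -> mu A < +oo ;
  mm_positive_open : forall U, open U -> U !=set0 -> 0 < mu U
}.

End metric_measure_space.

Section morrey.
Context {R : realType} {X : pmetricType R}.
Variable mu : {outer_measure set X -> \bar R}.
Local Open Scope ereal_scope.

Local Notation T := (caratheodory_type mu).
Local Notation muT := (mu : set T -> \bar R).

(* Functions take extended real values, since [modified_maximal] may be
   infinite on a null set; real-valued [f] embed as [EFin \o f]. *)
Implicit Type f : T -> \bar R.

Definition Lp_loc (p : R) : set (T -> \bar R) :=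
  [set f : T -> \bar R | measurable_fun setT f /\
    forall x : X, exists2 r : R, (0 < r)%R &
      \int[muT]_(y in ball x r) (`|f y| `^ p) < +oo].

Definition morrey_norm (p q k : R) f : \bar R :=
  ereal_sup [set mu (ball xr.1 (k * xr.2)%R) `^ (q^-1 - p^-1)%R *
                 (\int[muT]_(y in ball xr.1 xr.2) (`|f y| `^ p)) `^ p^-1%R
            | xr in [set xr : X * R | (0 < xr.2)%R]].

Definition morrey_space (p q k : R) : set (T -> \bar R) :=
  [set f : T -> \bar R | Lp_loc p f /\ morrey_norm p q k f < +oo].

Definition modified_maximal (beta : R) f : T -> \bar R :=
  fun x => ereal_sup
    [set (mu (ball (x : X) (beta * r)%R))^-1 *
         \int[muT]_(y in ball (x : X) r) `|f y|
    | r in [set r : R | (0 < r)%R]].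

End morrey.

Arguments Lp_loc {R X} mu p.
Arguments morrey_norm {R X} mu p q k f.
Arguments morrey_space {R X} mu p q k.
Arguments modified_maximal {R X} mu beta f.

(* Main.v *)
Require Import Defs.
From mathcomp Require Import all_boot all_order all_algebra.
From mathcomp Require Import all_classical all_reals all_analysis.
From mathcomp Require Import measurable_realfun ring lra.

(** Boundedness of the modified maximal operator on Morrey spaces.

    Everything takes place on one ball [B(x,r)], where [M f] is split according
    to the radius [s] of the averaging ball [B(y,s)].

    Large radii, [s >= 2r]: then [B(x,r)] lies in [B(y, beta s)], so the Morrey
    bound of [f] on [B(y,s)] makes the average at most a constant multiple of
    [||f|| mu(B(x,r))^(-1/q)].  This takes the norm with parameter [beta], but
    in a doubling space any two parameters [k > 1] give equivalent norms,
    because a ball is covered by boundedly many small balls whose dilations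
    remain inside a slightly larger concentric ball [morrey_bounded_change].

    Small radii, [s < 2r]: only the values of [f] on [B(x,3r)] are seen, so the
    local L^p boundedness of the maximal operator suffices.  It comes from a
    weak type (1,1) inequality [weak_type] and a dyadic form of Marcinkiewicz
    interpolation ([integral_le_levels], [levels_le_integral]).

    For the weak type inequality, select centres greedily by decreasing radius,
    discarding those covered by an already selected dilated ball
    [B(z, beta s_z)].  The dilated selected balls cover.  When undilated ones
    share a point, every radius exceeds [beta - 1] times the largest one and the
    centres are separated proportionally to that radius, so geometric doubling
    bounds their number [doubling_overlap]: each point is counted boundedly
    often.  This is where [beta > 1] enters.

    Putting both ranges together gives the bound for the norm with parameter
    [3k] [morrey_bounded_maximal], and a last change of parameter returns
    to [k]. *)

Set Implicit Arguments.
Unset Strict Implicit.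
Unset Printing Implicit Defensive.

Import Order.TTheory GRing.Theory Num.Theory.

Local Open Scope classical_set_scope.
Local Open Scope ring_scope.

(** * Coverings in geometrically doubling spaces *)

Lemma uniq_size_le_card (T : choiceType) (u : seq T) n :
  uniq u -> ([set` u] #<= `I_n)%card -> (size u <= n)%N.
Proof.
move=> uu; rewrite -card_le_II; apply: card_le_trans.
have -> : `I_(size u) = index^~ u @` [set` u].
  apply/seteqP; split => [i /= iu|_ /= [z zu <-]]; last by rewrite index_mem.
  case: u uu iu => // a u uu iu.
  by exists (nth a (a :: u) i); [exact: mem_nth|exact: index_uniq].
exact: card_image_le.
Qed.

Lemma maximal_seq (T : Type) (P : seq T -> Prop) (N : nat) :
  P [::] -> (forall u, P u -> (size u <= N)%N) ->
  exists2 u, P u & forall y, ~ P (y :: u).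
Proof.
move=> P0 PN.
pose Q := [pred n : nat | `[< exists2 u, P u & size u = n >]].
have exQ : exists n, Q n by exists 0%N; apply/asboolP; exists [::].
have QN n : Q n -> (n <= N)%N by move=> /asboolP[u /PN uN <-].
case: (ex_maxnP exQ QN) => m /asboolP[u Pu um] mmax; exists u => // y Pyu.
suff : (m.+1 <= m)%N by rewrite ltnn.
by apply: mmax; apply/asboolP; exists (y :: u); rewrite //= um.
Qed.

Section doubling.
Context {R : realType} {X : pmetricType R}.
Implicit Types (x y z w : X) (r e : R) (s t u : seq X) (A E : set X).

Lemma in_ball x y r : ball x r y <-> mdist x y < r.
Proof. by rewrite ballEmdist. Qed.

Hypothesis dX : geometrically_doubling X.

(** A maximal [r/2]-separated set has at most [N0] points and every other point
    is within [r/2] of it.  The factor [3/4] rather than [1/2] accommodates the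
    strict inequality defining open balls. *)
Lemma doubling_halving : exists N : nat, forall x r E, 0 < r ->
  E `<=` ball x r -> exists u : seq X, [/\ (size u <= N)%N,
    {in u, forall y, E y} &
    forall y, E y -> exists2 z, z \in u & mdist z y < 3 / 4 * r].
Proof.
have [N dN] := dX; exists N => x r E r0 Er.
pose P u := {in u, forall y, E y} /\ pairwise (fun y z => r / 2 < mdist y z) u.
have PN u : P u -> (size u <= N)%N.
  move=> [uE uP]; apply: uniq_size_le_card.
    apply: pairwise_uniq uP => z; rewrite mdistxx.
    by apply/negbTE; rewrite -leNgt divr_ge0// ltW.
  apply: (dN x r _ r0) => [z /= /uE/Er//|y z /= yu zu yz].
  have /(pairwiseP x) H := uP; have iy := index_mem y u; have iz := index_mem z u.
  case: (ltngtP (index y u) (index z u)) => [lt|lt|eqi].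
  - by have := H _ _ _ _ lt; rewrite !nth_index// !inE !index_mem; exact.
  - by rewrite metric_sym; have := H _ _ _ _ lt;
      rewrite !nth_index// !inE !index_mem; exact.
  - by case: yz; rewrite -(nth_index x yu) -(nth_index x zu) eqi.
have [] := @maximal_seq _ P N _ PN; first by split.
move=> u Pu umax; exists u; split; [exact: PN|by case: Pu|].
move=> y Ey; apply: contrapT => nz; apply: (umax y); split.
  by move=> z; rewrite inE => /predU1P[->//|]; apply: (proj1 Pu).
rewrite /= (proj2 Pu) andbT; apply/allP => z zu.
rewrite ltNge; apply/negP => yz; apply: nz; exists z => //.
rewrite metric_sym (le_lt_trans yz)//; nra.
Qed.

(** Iterating [doubling_halving] inside the pieces keeps all centres in [E],
    which is what later keeps dilated covering balls near the original ball. *)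
Lemma doubling_cover e : 0 < e -> exists N : nat, forall x r E, 0 < r ->
  E `<=` ball x r -> exists u : seq X, [/\ (size u <= N)%N,
    {in u, forall y, E y} &
    forall y, E y -> exists2 z, z \in u & mdist z y < e * r].
Proof.
move=> e0; have [N dN] := doubling_halving.
have [m me] : exists m, 2 * (3 / 4 : R) ^+ m < e.
  have : (3 / 4 : R^o) ^+ m @[m --> \oo] --> (0 : R^o).
    by apply: cvg_expr; rewrite ger0_norm; lra.
  have e20 : 0 < e / 2 by lra.
  move=> /cvgrPdist_lt/(_ _ e20)[m _ /(_ m (leqnn m))]/=.
  have p0 : 0 <= (3 / 4 : R) ^+ m by apply: exprn_ge0; lra.
  by rewrite sub0r normrN (ger0_norm p0) => lt; exists m; lra.
exists (N ^ m)%N => x r E r0 Er.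
(* The factor 2: to start with a centre in [E] itself, a ball of radius [2r]
   is needed to cover [E]. *)
pose rm n := 2 * (3 / 4) ^+ n * r.
have rm0 n : 0 < rm n by rewrite !mulr_gt0// exprn_gt0//; lra.
suff [u [uN uE uc]] : exists u : seq X, [/\ (size u <= N ^ m)%N,
    {in u, forall y, E y} &
    forall y, E y -> exists2 z, z \in u & mdist z y < rm m].
  exists u; split=> // y /uc[z zu zy]; exists z => //.
  by rewrite (lt_le_trans zy)// ler_wpM2r// ltW.
elim: m {me} => [|m [u [uN uE uc]]].
  have [[z Ez]|E0] := pselect (exists z, E z); last first.
    by exists [::]; split => // y Ey; case: E0; exists y.
  exists [:: z]; split => // [y|y Ey]; first by rewrite inE => /eqP->.
  exists z; first by rewrite inE.
  have /in_ball := Er _ Ez; have /in_ball := Er _ Ey.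
  have := metric_triangle z x y; rewrite (metric_sym z x) /rm; lra.
have /choice[c hc] : forall z, exists u : seq X, [/\ (size u <= N)%N,
    {in u, forall y, E y} &
    forall y, E y -> ball z (rm m) y ->
      exists2 w, w \in u & mdist w y < 3 / 4 * rm m].
  move=> z; have [|v [vN vE vc]] := dN z (rm m) (E `&` ball z (rm m)) (rm0 m).
    exact: subIsetr.
  exists v; split => // [y /vE[]//|y Ey zy]; exact: vc.
exists (flatten [seq c z | z <- u]); split.
- rewrite size_flatten /shape -map_comp expnSr.
  apply: (@leq_trans (size u * N)); last by rewrite leq_mul2r uN orbT.
  elim: (u) => //= z v ih; rewrite mulSn leq_add//; by case: (hc z).
- by move=> y /flatten_mapP[z zu]; have [_ h _] := hc z; exact: h.
- move=> y Ey; have [z zu zy] := uc y Ey.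
  have [_ _ /(_ y Ey)[|w wc wy]] := hc z; first exact/in_ball.
  exists w; last by rewrite (_ : rm m.+1 = 3 / 4 * rm m)// /rm exprS; ring.
  by apply/flatten_mapP; exists z.
Qed.

(** Pigeonhole: cover by balls of radius [e r / 2], each of which contains at
    most one point of an [e r]-separated family. *)
Lemma doubling_separated e : 0 < e -> exists N : nat, forall x r u, 0 < r ->
  {in u, forall y, ball x r y} ->
  pairwise (fun y z => e * r <= mdist y z) u -> (size u <= N)%N.
Proof.
move=> e0; have [|N dN] := @doubling_cover (e / 2); first by rewrite divr_gt0.
exists N => x r u r0 ur usep.
have [|c [cN _ cc]] := dN x r [set` u] r0; first exact: ur.
have {}cc y : exists z, y \in u -> z \in c /\ mdist z y < e / 2 * r.
  have [yu|yu] := boolP (y \in u); last by exists x.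
  by have [z zc zy] := cc y yu; exists z.
have [f fc] := choice cc.
rewrite (leq_trans _ cN)// -(size_map f); apply: uniq_leq_size; last first.
  by move=> _ /mapP[y yu ->]; have [] := fc y yu.
rewrite uniq_pairwise pairwise_map.
apply: (sub_in_pairwise (P := mem u)) (usep); last exact/allP.
move=> y z yu zu yz /=; apply/eqP => fyz.
have [_ fy] := fc y yu; have [_ fz] := fc z zu.
have := metric_triangle y (f y) z; rewrite (metric_sym y (f y)) => tri.
move: yz fy fz tri; rewrite -fyz; lra.
Qed.

(** The [z] counted have balls that share the point [y].  The first of them has
    the largest radius [s z0]; all centres lie in [B(y, s z0)].  For a later one
    [w], [beta s_z0 <= d(z0,w) < s_z0 + s_w], hence [s_w > (beta - 1) s_z0]: the
    radii are comparable, so the centres are [(beta - 1) s_z0]-separated. *)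
Lemma doubling_overlap beta : 1 < beta -> exists N : nat,
  forall (s : X -> R) u y, {in u, forall z, 0 < s z} ->
  pairwise (fun z w => (beta * s z <= mdist z w) && (s w <= s z)) u ->
  (count (fun z => (mdist z y < s z)%R) u <= N)%N.
Proof.
move=> b1; have [|N sepN] := @doubling_separated (beta - 1).
  by rewrite subr_gt0.
exists N => s u y s0 us; rewrite -size_filter.
have := subseq_pairwise (filter_subseq (fun z => mdist z y < s z) u) us.
have : {in [seq z <- u | mdist z y < s z], forall z, 0 < s z /\ mdist z y < s z}.
  by move=> z; rewrite mem_filter => /andP[zy zu]; split => //; exact: s0.
case: [seq z <- u | mdist z y < s z] => [//|z0 v] zv /= /andP[/allP z0v vs].
have [s00 z0y] := zv z0 (mem_head _ _).
apply: (sepN y (s z0) (z0 :: v)) => //.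
  move=> z; rewrite inE => /predU1P[->|zinv].
    by apply/in_ball; rewrite metric_sym.
  have [_ zy] : 0 < s z /\ mdist z y < s z by apply: zv; rewrite inE zinv orbT.
  apply/in_ball; rewrite metric_sym (lt_le_trans zy)//.
  by have /andP[] := z0v _ zinv.
rewrite /=; apply/andP; split.
  apply/allP => z zinv; have /andP[bz _] := z0v z zinv.
  by rewrite (le_trans _ bz)// ler_wpM2r// ?ltW//; lra.
apply: (sub_in_pairwise (P := mem v)) (vs); last exact/allP.
move=> z w zinv winv /andP[zw _].
have /andP[bz _] := z0v z zinv.
have [sz0 zy] : 0 < s z /\ mdist z y < s z by apply: zv; rewrite inE zinv orbT.
have := metric_triangle z0 y z; rewrite (metric_sym y) => tri.
have sz : (beta - 1) * s z0 < s z by lra.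
by rewrite (le_trans _ zw)// (le_trans (ltW sz))// ler_peMl// ltW.
Qed.

(** With finitely many radii a centre of largest radius exists at each step.
    The radii are also bounded below, so the selected centres are uniformly
    separated; the induction is on the resulting bound for their number. *)
Lemma greedy_selection beta (rs : seq R) (s : X -> R) A x r : 1 < beta ->
  {in rs, forall h, 0 < h} -> 0 < r -> A `<=` ball x r ->
  (forall y, A y -> s y \in rs) ->
  exists u, [/\ {in u, forall y, A y},
    forall y, A y -> exists2 z, z \in u & mdist z y < beta * s z &
    pairwise (fun z w => (beta * s z <= mdist z w) && (s w <= s z)) u].
Proof.
move=> b1 rs0 r0 Ar As.
have [eta eta0 rseta] : exists2 eta, 0 < eta & {in rs, forall h, eta <= h}.
  elim: {As} rs rs0 => [|h rs ih] rs0; first by exists 1.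
  have [k krs|eta eta0 etars] := ih; first by rewrite rs0// inE krs orbT.
  exists (Num.min h eta); first by rewrite lt_min eta0 rs0// mem_head.
  move=> k; rewrite inE ge_min => /predU1P[->|/etars ->]; first by rewrite lexx.
  by rewrite orbT.
have [|N sepN] := @doubling_separated (eta / r); first by rewrite divr_gt0.
have {}sepN u : {in u, forall y, A y} ->
    pairwise (fun y z => eta <= mdist y z) u -> (size u <= N)%N.
  move=> uA usep; apply: (sepN x r u r0) => [y /uA/Ar//|].
  by rewrite divfK ?gt_eqF.
elim: N A Ar As sepN => [|N ih] A Ar As sepN.
  exists [::]; split => // y Ay.
  suff : (size [:: y] <= 0)%N by [].
  by apply: sepN => // z; rewrite inE => /eqP->.
have [[y0 Ay0]|A0] := pselect (exists y, A y); last first.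
  by exists [::]; split => // y Ay; case: A0; exists y.
have [z Az zmax] : exists2 z, A z & forall w, A w -> s w <= s z.
  suff [z Az zmax] : exists2 z, A z & forall w, A w -> s w \in rs -> s w <= s z.
    by exists z => // w Aw; exact/zmax/As.
  elim: (rs) => [|h hs [z Az zmax]]; first by exists y0.
  have [[w Aw sw]|hz] := pselect (exists2 w, A w & s w = h /\ s z < h).
    case: sw => swh sw; exists w => // v Av; rewrite inE swh.
    move=> /predU1P[->//|/(zmax v Av)].
    by move/le_trans; apply; exact: ltW.
  exists z => // w Aw; rewrite inE => /predU1P[swh|]; last exact: zmax.
  by rewrite leNgt; apply/negP => zw; apply: hz; exists w; rewrite // -swh.
have sz0 : eta <= s z by apply/rseta/As.
have [|||u [uA uc us]] := ih (A `&` [set w | beta * s z <= mdist z w]).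
- by move=> w [/Ar].
- by move=> w [/As].
- move=> u uA usep; have := sepN (z :: u); apply.
    by move=> w; rewrite inE => /predU1P[->//|/uA[]].
  rewrite /= usep andbT; apply/allP => w /uA[_ /= zw].
  rewrite (le_trans _ zw)//; nra.
exists (z :: u); split.
- by move=> w; rewrite inE => /predU1P[->//|/uA[]].
- move=> w Aw; have [zw|zw] := ltP (mdist z w) (beta * s z).
    by exists z => //; rewrite mem_head.
  have [|v vu vw] := uc w; first by split.
  by exists v => //; rewrite inE vu orbT.
- rewrite /= us andbT; apply/allP => w /uA[Aw zw].
  by rewrite zw zmax.
Qed.
End doubling.

(** * Balls and the measure *)

(** Source of the countable set of radii that suffices for the maximal
    function. *)
Lemma rational_radii (R : realType) :
  exists h : nat -> R, forall a b, a < b -> exists n, a < h n < b.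
Proof.
exists (fun n => if unpickle n is Some q then ratr q else 0).
move=> a b ab; have [q] := rat_in_itvoo ab; rewrite in_itv /= => qab.
by exists (pickle q); rewrite pickleK.
Qed.

Section ball_measure.
Context {R : realType} {X : pmetricType R} {mu : {outer_measure set X -> \bar R}}.
Local Notation T := (caratheodory_type mu).
Local Notation muT := (mu : set T -> \bar R).
Hypothesis mmu : metric_measure mu.
Local Open Scope ereal_scope.
Implicit Types (x y z : X) (r s a b : R) (f g : T -> \bar R).

Lemma open_mball x r : open (ball x r : set X).
Proof.
rewrite openE => y /in_ball xy; apply/nbhs_ballP; exists (r - mdist x y)%R.
  by rewrite /= subr_gt0.
move=> z /in_ball yz; apply/in_ball; have := metric_triangle x y z; lra.
Qed.

Lemma measurable_open (U : set X) : open U -> measurable (U : set T).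
Proof.
by move=> oU; have [_ [+ _] _ _ _] := mmu; apply; exact: sub_sigma_algebra.
Qed.

Lemma measurable_mball x r : measurable (ball x r : set T).
Proof. exact/measurable_open/open_mball. Qed.

Lemma mu_ball_gt0 x r : (0 < r)%R -> 0 < mu (ball x r).
Proof.
move=> r0; apply: (mm_positive_open mmu); first exact: open_mball.
by exists x; apply/in_ball; rewrite mdistxx.
Qed.

(** Real-valued, as balls have finite measure: powers of it can then be handled
    by real arithmetic. *)
Definition vol x r : R := fine (mu (ball x r)).

Lemma mu_ballE x r : mu (ball x r) = (vol x r)%:E.
Proof.
rewrite /vol fineK// ge0_fin_numE ?outer_measure_ge0//.
by apply: (mm_finite_bounded mmu); exists x, r.
Qed.

Lemma vol_gt0 x r : (0 < r)%R -> (0 < vol x r)%R.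
Proof. by move=> r0; rewrite -lte_fin -mu_ballE mu_ball_gt0. Qed.

Lemma ball_subset x y r s : (mdist x y + r <= s)%R -> ball y r `<=` ball x s.
Proof.
move=> xyrs z /in_ball yz; apply/in_ball.
have := metric_triangle x y z; lra.
Qed.

Lemma vol_le x y r s : ball x r `<=` ball y s -> (vol x r <= vol y s)%R.
Proof. by move=> rs; rewrite -lee_fin -!mu_ballE le_outer_measure. Qed.

Section nonnegative_function.
Variable g : T -> \bar R.
Hypotheses (mg : measurable_fun setT g) (g0 : forall y, 0 <= g y).

Lemma le_integral_set (A B : set T) : measurable A -> measurable B ->
  A `<=` B -> \int[muT]_(y in A) g y <= \int[muT]_(y in B) g y.
Proof.
move=> mA mB AB; apply: ge0_subset_integral => //.
exact: measurable_funTS.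
Qed.

(** An open ball is the increasing union of the concentric open balls of
    smaller radius. *)
Lemma integral_ball_left_continuous x r b :
  b%:E < \int[muT]_(y in ball x r) g y ->
  exists2 s, (s < r)%R & b%:E < \int[muT]_(y in ball x s) g y.
Proof.
move=> blt; pose F (n : nat) : set T := ball x (r - n.+1%:R^-1)%R.
have mF n : measurable (F n) by exact: measurable_mball.
have ndF : nondecreasing_seq F.
  move=> m n mn; apply/subsetPset; apply: ball_subset.
  by rewrite mdistxx add0r lerB// lef_pV2 ?posrE// ler_nat.
have FE : \bigcup_n F n = ball x r.
  apply/seteqP; split => [y [n _]|y /in_ball xy].
    by apply: ball_subset; rewrite mdistxx add0r gerBl.
  have [n nr] := ltr_add_invr (xy : (mdist x y < r)%R).
  by exists n => //; apply/in_ball; rewrite ltrBrDr.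
have := @ge0_nondecreasing_set_cvg_integral _ _ _ F g muT ndF mF.
rewrite FE => /(_ (fun i => measurable_funTS mg) (fun i y _ => g0 y)) cvgF.
have [n bn] : exists n, b%:E < \int[muT]_(y in F n) g y.
  apply: contrapT => /forallNP nb; move: blt; rewrite ltNge => /negP; apply.
  move/cvg_lim : cvgF => <-//; apply: lime_le.
    apply: ereal_nondecreasing_is_cvgn => m n mn.
    by apply: le_integral_set => //; exact/subsetPset/ndF.
  by apply: nearW => n; rewrite leNgt; exact/negP/nb.
by exists (r - n.+1%:R^-1)%R => //; rewrite gtrBl.
Qed.

(** Left continuity in the radius makes [x |-> int_(B(x,r)) g] lower
    semicontinuous: if [s < r] already gives an integral above [b], then so do
    all balls [B(z,r)] with [d(x,z) < r - s]. *)
Lemma measurable_integral_ball r :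
  measurable_fun setT ((fun x => \int[muT]_(y in ball (x : X) r) g y) : T -> _).
Proof.
move=> mD; apply: (measurability _ (ErealGenOInfty.measurableE R)) => //.
move=> _ [_ [b ->] <-]; rewrite setTI; apply: measurable_open.
rewrite openE => x; rewrite /= in_itv /= andbT => bx.
have [s sr bs] := integral_ball_left_continuous bx.
apply/nbhs_ballP; exists (r - s)%R => /=; first by rewrite subr_gt0.
move=> z /in_ball xz; rewrite /= in_itv /= andbT (lt_le_trans bs)//.
apply: le_integral_set; [exact: measurable_mball..|].
by apply: ball_subset; rewrite metric_sym; lra.
Qed.

End nonnegative_function.

Lemma measurable_mu_ball r :
  measurable_fun setT ((fun x => mu (ball (x : X) r)) : T -> _).
Proof.
rewrite (_ : (fun x => _) = fun x => \int[muT]_(y in ball (x : X) r) cst 1 y).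
  exact: measurable_integral_ball.
by apply/funext => x; rewrite integral_cst ?mul1e//; exact: measurable_mball.
Qed.

End ball_measure.
Arguments vol {R X} mu x r.

(** * The weak type (1,1) inequality *)

Section weak_type.
Context {R : realType} {X : pmetricType R} {mu : {outer_measure set X -> \bar R}}.
Local Notation T := (caratheodory_type mu).
Local Notation muT := (mu : set T -> \bar R).
Hypotheses (dX : geometrically_doubling X) (mmu : metric_measure mu).
Local Open Scope ereal_scope.
Implicit Types (x y z : X) (r s a b : R) (g : T -> \bar R).

Lemma outer_measure_cover (u : seq X) (F : X -> set X) (A : set X) :
  (forall y, A y -> exists2 z, z \in u & F z y) ->
  mu A <= \sum_(z <- u) mu (F z).
Proof.
elim: u A => [|z u ih] A uA.
  rewrite big_nil (_ : A = set0) ?outer_measure0// -subset0.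
  by move=> y /uA[].
rewrite big_cons (le_trans (le_outer_measureIC mu (F z) A))//.
apply: leeD; first by apply: le_outer_measure; exact: subIsetr.
apply: ih => y [/uA[w]]; rewrite inE => /predU1P[->//|wu Fw _].
by exists w.
Qed.

(** Pointwise, the sum of the truncations of [g] to the sets [F z] is [g]
    multiplied by the number of sets containing the point. *)
Lemma sum_integral_overlap (N : nat) g (u : seq X) (F : X -> set T)
    (U : set T) : measurable_fun setT g -> (forall y, 0 <= g y) ->
  measurable U -> (forall z, measurable (F z)) ->
  {in u, forall z, F z `<=` U} ->
  (forall y, (count (fun z => `[< F z y >]) u <= N)%N) ->
  \sum_(z <- u) \int[muT]_(y in F z) g y <= N%:R%:E * \int[muT]_(y in U) g y.
Proof.
move=> mg g0 mU mF FU uN.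
have mgF z : measurable_fun U (g \_ (F z)).
  by apply/measurable_restrict => //; exact: measurable_funTS.
have gF0 z y : 0 <= (g \_ (F z)) y by rewrite patchE; case: ifP.
rewrite (eq_big_seq (fun z => \int[muT]_(y in U) (g \_ (F z)) y)); last first.
  by move=> z /FU FzU; rewrite -integral_mkcondr setIidr.
rewrite -ge0_integral_sum// -ge0_integralZl_EFin//; last exact: measurable_funTS.
apply: ge0_le_integral => //.
- by move=> y _; exact: sume_ge0.
- exact: emeasurable_sum.
- by apply: measurable_funeM; exact: measurable_funTS.
move=> y _; apply: (@le_trans _ _
    ((count (fun z => `[< F z y >]) u)%:R%:E * g y)); last first.
  by apply: lee_wpmul2r => //; rewrite lee_fin ler_nat.
elim: (u) => [|z v ih]; first by rewrite big_nil mul0e.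
rewrite big_cons /= natrD EFinD ge0_muleDl ?lee_fin//.
apply: leeD => //; rewrite patchE.
case: asboolP => Fzy; first by rewrite mem_set// mul1e.
by rewrite memNset// mul0e.
Qed.

(** The covering argument: the dilated selected balls cover [A] and the
    undilated ones overlap at most [N] times. *)
Lemma weak_type_finite_radii beta : (1 < beta)%R -> exists N : nat,
  forall g (A U : set T) x r (lam : R) (rs : seq R),
  measurable_fun setT g -> (forall y, 0 <= g y) -> (0 <= lam)%R ->
  {in rs, forall s, 0 < s}%R -> (0 < r)%R -> A `<=` ball x r -> measurable U ->
  (forall y : X, A y -> exists2 s, s \in rs &
     (ball y s : set X) `<=` U /\ lam%:E * mu (ball y (beta * s)%R) <=
                     \int[muT]_(z in ball y s) g z) ->
  lam%:E * mu A <= N%:R%:E * \int[muT]_(y in U) g y.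
Proof.
move=> b1; have [N ovN] := doubling_overlap dX b1.
exists N => g A U x r lam rs mg g0 lam0 rs0 r0 Ar mU As.
have {}As (y : X) : exists s, A y -> [/\ s \in rs, (ball y s : set X) `<=` U &
    lam%:E * mu (ball y (beta * s)%R) <= \int[muT]_(z in ball y s) g z].
  have [/As[s srs [sU sg]]|] := pselect (A y); first by exists s.
  by exists 0%R.
have [s sP] := choice As.
have [|u [uA uc us]] := greedy_selection dX b1 rs0 r0 Ar (s := s).
  by move=> y /sP[].
apply: (@le_trans _ _ (\sum_(z <- u) lam%:E * mu (ball z (beta * s z)%R))).
  rewrite -ge0_sume_distrr; last by move=> z _; exact: outer_measure_ge0.
  rewrite lee_pmul// ?lee_fin//.
  apply: outer_measure_cover => y /uc[z zu zy]; exists z => //.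
  exact/in_ball.
apply: (@le_trans _ _ (\sum_(z <- u) \int[muT]_(y in ball z (s z)) g y)).
  rewrite big_seq [leRHS]big_seq; apply: lee_sum => z zu.
  by have [] := sP z (uA z zu).
apply: sum_integral_overlap => //.
- by move=> z; exact: measurable_mball.
- by move=> z zu; have [] := sP z (uA z zu).
- move=> y; rewrite (leq_trans _ (ovN s u y _ us))//.
    by apply: sub_count => z /asboolP/in_ball.
  by move=> z zu; apply: rs0; have [] := sP z (uA z zu).
Qed.

(** A radius [s] can be lowered to a radius [h n]: the integral survives by left
    continuity, and the measure of the dilated ball only decreases. *)
Lemma lt_average_dense_radii (h : nat -> R) beta g x a b lam : (0 < beta)%R ->
  (forall a b, (a < b)%R -> exists n, (a < h n < b)%R) ->
  measurable_fun setT g -> (forall y, 0 <= g y) -> (0 <= lam)%R ->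
  (exists2 s, (a < s < b)%R &
     lam%:E * mu (ball x (beta * s)%R) < \int[muT]_(z in ball x s) g z) <->
  (exists2 n, (a < h n < b)%R &
     lam%:E * mu (ball x (beta * h n)%R) < \int[muT]_(z in ball x (h n)) g z).
Proof.
move=> b0 hd mg g0 lam0; split=> [[s /andP[as_ sb] ls]|[n nab ln]]; last first.
  by exists (h n).
move: (ls); rewrite (mu_ballE mmu) -EFinM.
move=> /(integral_ball_left_continuous mmu mg g0)[t ts lt].
have [|n /andP[tn ns]] := hd (Num.max a t) s; first by rewrite gt_max as_.
move: tn; rewrite gt_max => /andP[an tn].
exists n; first by rewrite an (lt_trans ns).
apply: (@lt_le_trans _ _ (\int[muT]_(z in ball x t) g z)).
  apply: le_lt_trans lt; rewrite (mu_ballE mmu) -EFinM lee_fin ler_wpM2l//.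
  by apply: (vol_le mmu); apply: ball_subset; rewrite mdistxx add0r ler_pM2l// ltW.
apply: (le_integral_set mg g0); [exact: (measurable_mball mmu)..|].
by apply: ball_subset; rewrite mdistxx add0r ltW.
Qed.

(** The average over [B(y,s)] exceeds [lam]; clearing the division by the
    measure leaves two measurable functions of [y] to compare. *)
Definition exceeds beta g (lam a b : R) : set T := [set y |
  exists2 s, (a < s < b)%R &
     lam%:E * mu (ball (y : X) (beta * s)%R) < \int[muT]_(z in ball (y : X) s) g z].

Definition exceeds_at beta g (lam a b s : R) : set T := [set y | (a < s < b)%R /\
     lam%:E * mu (ball (y : X) (beta * s)%R) < \int[muT]_(z in ball (y : X) s) g z].

Section exceeds.
Variables (beta : R) (g : T -> \bar R).
Hypotheses (beta_gt0 : (0 < beta)%R) (mg : measurable_fun setT g).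
Hypothesis (g0 : forall y, 0 <= g y).

Lemma measurable_exceeds_at lam a b s :
  measurable (exceeds_at beta g lam a b s).
Proof.
have [asb|asb] := boolP (a < s < b)%R; last first.
  rewrite (_ : exceeds_at _ _ _ _ _ _ = set0)// -subset0 => y [].
  by rewrite (negbTE asb).
rewrite (_ : exceeds_at _ _ _ _ _ _ = setT `&` [set y : T |
   lam%:E * mu (ball (y : X) (beta * s)%R) < \int[muT]_(z in ball (y : X) s) g z]).
  apply: measurable_lte => //; last exact: measurable_integral_ball.
  by apply: measurable_funeM; exact: measurable_mu_ball.
by rewrite setTI; apply/seteqP; split => [y []//|y].
Qed.

Lemma exceeds_bigcup (h : nat -> R) lam a b : (0 <= lam)%R ->
  (forall a b, (a < b)%R -> exists n, (a < h n < b)%R) ->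
  exceeds beta g lam a b = \bigcup_n exceeds_at beta g lam a b (h n).
Proof.
move=> lam0 hd; apply/seteqP; split=> [y|y [n _ [nab ln]]]; last by exists (h n).
move/(lt_average_dense_radii y a b beta_gt0 hd mg g0 lam0) => [n nab ln].
by exists n.
Qed.

Lemma measurable_exceeds lam a b : (0 <= lam)%R ->
  measurable (exceeds beta g lam a b).
Proof.
move=> lam0; have [h hd] := rational_radii R.
rewrite (exceeds_bigcup a b lam0 hd); apply: bigcup_measurable => n _.
exact: measurable_exceeds_at.
Qed.

End exceeds.

(** Passage from finitely many radii to all of them, by continuity from below
    along an enumeration of the radii. *)
Lemma weak_type beta : (1 < beta)%R -> exists N : nat,
  forall g x r (lam : R),
  measurable_fun setT g -> (forall y, 0 <= g y) -> (0 <= lam)%R -> (0 < r)%R ->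
  lam%:E * mu (ball x r `&` exceeds beta g lam 0 (2 * r)) <=
  N%:R%:E * \int[muT]_(y in ball x (3 * r)%R) g y.
Proof.
move=> b1; have [N wtN] := weak_type_finite_radii b1; exists N.
move=> g x r lam mg g0 lam0 r0; have [h hd] := rational_radii R.
have b0 : (0 < beta)%R by lra.
rewrite (exceeds_bigcup b0 mg g0 _ _ lam0 hd) setI_bigcupr.
pose E n : set T := ball x r `&` exceeds_at beta g lam 0 (2 * r) (h n).
pose F n : set T := \bigcup_(k in `I_n) E k.
have mE n : measurable (E n).
  apply: measurableI; [exact: measurable_mball|exact: measurable_exceeds_at].
have mF n : measurable (F n) by apply: bigcup_measurable.
have -> : \bigcup_n E n = \bigcup_n F n.
  apply/seteqP; split=> [y [n _ En]|y [n _ [k _ Ek]]]; last by exists k.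
  by exists n.+1 => //; exists n => /=.
have ndF : nondecreasing_seq F.
  move=> m n mn; apply/subsetPset => y [k /= km Ek]; exists k => //=.
  exact: leq_trans mn.
have : lam%:E * mu (F n) @[n --> \oo] --> lam%:E * mu (\bigcup_n F n).
  apply: cvgeZl => //; apply: (@nondecreasing_cvg_mu _ _ _ muT) => //.
  exact: bigcup_measurable.
move=> cvgF; rewrite -(cvg_lim _ cvgF)//; apply: lime_le.
  exact: cvgP cvgF.
apply: nearW => n.
apply: (wtN g (F n) (ball x (3 * r)%R) x r lam
  [seq s <- [seq h k | k <- iota 0 n] | (0 < s < 2 * r)%R]) => //.
- by move=> s; rewrite mem_filter => /andP[/andP[]].
- by move=> y [k _ []].
- exact: measurable_mball.
- move=> y [k /= kn [xy [hk ly]]]; exists (h k).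
    rewrite mem_filter hk; apply: map_f.
    by rewrite mem_iota.
  split; last exact: ltW.
  apply: ball_subset; move/in_ball : xy; case/andP: hk; lra.
Qed.

End weak_type.

(** * Dyadic layer cakes *)

Section dyadic_levels.
Context {R : realType}.
Variables (p c : R).
Hypotheses (p_gt1 : 1 < p) (c_gt0 : 0 < c).
Implicit Type a : R.

Lemma level_gt0 j : 0 < c * 2 ^+ j.
Proof. by rewrite mulr_gt0// exprn_gt0. Qed.

Lemma powR2_gt1 : 1 < 2 `^ (p - 1) :> R.
Proof.
have {1}-> : 1 = 1 `^ (p - 1) :> R by rewrite powR1.
by rewrite gt0_ltr_powR ?nnegrE ?subr_gt0// ltr1n.
Qed.

(** The levels grow geometrically, so the sum is dominated by its last term. *)
Lemma sum_levels_below a n : 0 <= a ->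
  \sum_(j < n | c * 2 ^+ j < a) (c * 2 ^+ j) `^ (p - 1) <=
  2 `^ (p - 1) / (2 `^ (p - 1) - 1) * a `^ (p - 1).
Proof.
move=> a0; set w := 2 `^ (p - 1).
have p10 : 0 < p - 1 by rewrite subr_gt0.
have w1 : 1 < w by exact: powR2_gt1.
have wE j : (c * 2 ^+ j) `^ (p - 1) = c `^ (p - 1) * w ^+ j.
  rewrite powRM ?(ltW c_gt0) ?exprn_ge0//; congr (_ * _).
  by rewrite -powR_mulrn// -!powRrM mulrC powRrM powR_mulrn// powR_ge0.
have geo m : \sum_(j < m | c * 2 ^+ j < a) (c * 2 ^+ j) `^ (p - 1) <=
    c `^ (p - 1) * w ^+ m / (w - 1).
  elim: m => [|m ih].
    by rewrite big_ord0 divr_ge0 ?mulr_ge0 ?powR_ge0// ?expr0// subr_ge0 ltW.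
  rewrite big_mkcond big_ord_recr -big_mkcond /=.
  have le : (if c * 2 ^+ m < a then (c * 2 ^+ m) `^ (p - 1) else 0) <=
      c `^ (p - 1) * w ^+ m.
    rewrite wE; case: ifP => // _; rewrite mulr_ge0 ?powR_ge0 ?exprn_ge0//.
    by rewrite ltW// (lt_trans _ w1).
  rewrite (le_trans (lerD ih le))// exprS.
  rewrite le_eqVlt; apply/orP; left; apply/eqP; field.
  by rewrite gt_eqF// subr_gt0.
elim: n => [|n ih].
  by rewrite big_ord0 mulr_ge0 ?powR_ge0// divr_ge0 ?subr_ge0 ?powR_ge0// ltW.
have [na|na] := ltP (c * 2 ^+ n) a; last first.
  by rewrite big_mkcond big_ord_recr -big_mkcond /= ltNge na addr0.
rewrite (le_trans (geo n.+1))// exprS.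
have : c `^ (p - 1) * w ^+ n <= a `^ (p - 1).
  rewrite -wE ge0_ler_powR ?nnegrE//; [exact: ltW|exact/ltW/level_gt0|exact: ltW].
rewrite mulrCA mulrAC => H; rewrite ler_wpM2l// divr_ge0 ?subr_ge0 ?powR_ge0//.
exact: ltW.
Qed.

Lemma level_above a : c < a -> exists j, c * 2 ^+ j < a <= c * 2 ^+ j.+1.
Proof.
move=> ca; have : exists n, a <= c * 2 ^+ n.
  exists (Num.truncn (a / c)).+1; rewrite mulrC -ler_pdivrMr//.
  rewrite ltW// (lt_le_trans (truncnS_gt _))// -natrX ler_nat ltnW//.
  exact: ltn_expl.
case/ex_minnP => -[|n] an nmin; first by move: ca; rewrite ltNge -(mulr1 c) an.
exists n; rewrite an andbT ltNge; apply/negP => /nmin.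
by rewrite ltnn.
Qed.

Local Open Scope ereal_scope.

(** For finite [t > c] the term of the largest level below [t] is already at
    least [t^p]; the case of infinite [t] follows by monotonicity. *)
Lemma nneseries_levels_above (t : \bar R) : 0 <= t ->
  t `^ p <= (c `^ p)%:E + \sum_(j <oo) ((c * 2 ^+ j.+1) `^ p)%:E *
     (if (c * 2 ^+ j)%:E < t then 1 else 0).
Proof.
have p0 : (0 < p)%R by rewrite (lt_trans _ p_gt1).
pose F (t : \bar R) j := ((c * 2 ^+ j.+1) `^ p)%:E *
     (if (c * 2 ^+ j)%:E < t then 1 else 0).
have F0 u j : 0 <= F u j by rewrite mule_ge0 ?lee_fin ?powR_ge0//; case: ifP.
have real_case (a : R) : (0 <= a)%R ->
    a%:E `^ p <= (c `^ p)%:E + \sum_(j <oo) F a%:E j.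
  move=> a0; have [ac|ca] := leP a c.
    rewrite poweR_EFin (@le_trans _ _ (c `^ p)%:E)//.
      by rewrite lee_fin ge0_ler_powR ?nnegrE// ltW.
    by rewrite leeDl// nneseries_ge0.
  have [j /andP[ja aj]] := level_above ca.
  apply: (@le_trans _ _ (\sum_(0 <= i < j.+1) F a%:E i)); last first.
    rewrite (le_trans (nneseries_lim_ge _ _))// leeDr// lee_fin powR_ge0//.
  rewrite big_nat_recr//= (@le_trans _ _ (F a%:E j))//; last first.
    by rewrite leeDr// sume_ge0.
  rewrite /F lte_fin ja mule1 lee_fin ge0_ler_powR ?nnegrE//; first exact: ltW.
  exact/ltW/level_gt0.
case: t => [a| _|//]; first by rewrite lee_fin; exact: real_case.
suff -> : (c `^ p)%:E + \sum_(j <oo) F +oo j = +oo by rewrite leey.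
apply/eqyP => A A0; rewrite -[A in A%:E](@powRr1 _ A) ?(ltW A0)//.
rewrite -(@mulVf _ p) ?gt_eqF// powRrM -poweR_EFin.
rewrite (le_trans (real_case _ _)) ?powR_ge0//.
rewrite leeD2l//; apply: lee_nneseries => // j _; apply: lee_wpmul2l.
  by rewrite lee_fin powR_ge0.
by rewrite ltry; case: ifP.
Qed.

Lemma nneseries_levels_below (t : \bar R) : 0 <= t ->
  \sum_(j <oo) ((c * 2 ^+ j) `^ (p - 1))%:E *
     (if (c * 2 ^+ j / 2)%:E < t then t else 0) <=
  (2 `^ (p - 1) / (2 `^ (p - 1) - 1) * 2 `^ (p - 1))%:E * t `^ p.
Proof.
have p10 : (0 < p - 1)%R by rewrite subr_gt0.
have p0 : (0 < p)%R by rewrite (lt_trans _ p_gt1).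
have w1 : (1 < 2 `^ (p - 1))%R by exact: powR2_gt1.
case: t => [a| _|//]; last first.
  rewrite poweRyr ?gt_eqF// gt0_muley ?leey// lte_fin.
  by rewrite !mulr_gt0 ?invr_gt0 ?subr_gt0// (lt_trans _ w1).
rewrite lee_fin => a0; apply: lime_le.
  apply: is_cvg_nneseries => j _ _; rewrite mule_ge0 ?lee_fin ?powR_ge0//.
  by case: ifP.
apply: nearW => n; rewrite big_mkord.
rewrite (eq_bigr (fun j : 'I_n => ((if (c * 2 ^+ j < 2 * a)%R then
   (c * 2 ^+ j) `^ (p - 1) else 0) * a)%:E)); last first.
  move=> j _; rewrite lte_fin ltr_pdivrMr// (mulrC a).
  by case: ifP => _; rewrite ?mule0 ?mul0r// EFinM.
rewrite sumEFin -big_distrl -big_mkcond /= lee_fin.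
rewrite -(mulr_powRB1 a0 p0) mulrCA [leLHS]mulrC ler_wpM2l//.
by rewrite -(mulrA (2 `^ (p - 1) / _)%R) -powRM// sum_levels_below// mulr_ge0.
Qed.

End dyadic_levels.

(** * The maximal function *)

Section maximal.
Context {R : realType} {X : pmetricType R} {mu : {outer_measure set X -> \bar R}}.
Local Notation T := (caratheodory_type mu).
Local Notation muT := (mu : set T -> \bar R).
Hypotheses (dX : geometrically_doubling X) (mmu : metric_measure mu).
Variable beta : R.
Hypothesis beta_gt1 : (1 < beta)%R.
Local Open Scope ereal_scope.
Implicit Types (x y z : X) (r s lam : R) (f : T -> \bar R).

Local Notation M := (modified_maximal mu beta).

Let beta_gt0 : (0 < beta)%R. Proof. by rewrite (lt_trans _ beta_gt1). Qed.

(** Balls have finite positive measure, so the division in the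
    definition can be cleared. *)
Lemma maximal_gtP f y lam : (0 <= lam)%R ->
  lam%:E < M f y <-> exists2 s, (0 < s)%R &
    lam%:E * mu (ball y (beta * s)%R) < \int[muT]_(z in ball y s) `|f z|.
Proof.
move=> lam0.
have avgE s : (0 < s)%R -> (lam%:E < (mu (ball y (beta * s)%R))^-1 *
     \int[muT]_(z in ball y s) `|f z|) =
    (lam%:E * mu (ball y (beta * s)%R) < \int[muT]_(z in ball y s) `|f z|).
  move=> s0; have v0 := vol_gt0 mmu y (mulr_gt0 beta_gt0 s0).
  by rewrite (mu_ballE mmu) inver gt_eqF// lte_pdivlMl// muleC.
split=> [/ereal_sup_gt[_ [s s0 <-]]|[s s0 ls]].
  by rewrite avgE// => ls; exists s.
apply: (@lt_le_trans _ _ ((mu (ball y (beta * s)%R))^-1 *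
     \int[muT]_(z in ball y s) `|f z|)); first by rewrite avgE.
by apply: ereal_sup_ubound; exists s.
Qed.

Lemma maximal_ge0 f y : 0 <= M f y.
Proof.
apply: le_ereal_sup_tmp; eexists; first by exists 1%R; [exact: ltr01|reflexivity].
by rewrite mule_ge0 ?integral_ge0// inve_ge0 outer_measure_ge0.
Qed.

(** The superlevel sets are countable unions of sets [exceeds], over bounded
    ranges of radii. *)
Lemma measurable_maximal f : measurable_fun setT f -> measurable_fun setT (M f).
Proof.
move=> mf mD; apply: (measurability _ (ErealGenOInfty.measurableE R)) => //.
move=> _ [_ [lam ->] <-]; rewrite setTI.
have [lam0|lam0] := leP 0%R lam; last first.
  rewrite (_ : _ @^-1` _ = setT)//; apply/seteqP; split => // y _.
  by rewrite /= in_itv /= andbT (lt_le_trans _ (maximal_ge0 f y))// lte_fin.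
rewrite (_ : _ @^-1` _ = \bigcup_n exceeds beta (abse \o f) lam 0 n%:R).
  apply: bigcup_measurable => n _; apply: measurable_exceeds => //.
    exact: measurableT_comp.
  by move=> y; exact: abse_ge0.
apply/seteqP; split => [y|y [n _ [s /andP[s0 _] ls]]].
  rewrite /= in_itv /= andbT => /(maximal_gtP f y lam0)[s s0 ls].
  exists (Num.truncn s).+1 => //; exists s => //.
  by rewrite s0 truncnS_gt.
by rewrite /= in_itv /= andbT; apply/maximal_gtP => //; exists s.
Qed.

Lemma measurable_above_level f lam : measurable_fun setT f ->
  measurable_fun setT
    ((fun y => if lam%:E < `|f y| then `|f y| else 0) : T -> \bar R).
Proof.
move=> mf; have maf : measurable_fun setT (abse \o f) by exact: measurableT_comp.
by apply: measurable_fun_ifT => //; exact: measurable_fun_lte.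
Qed.

(** The part of [f] below [lam/2] contributes at most [lam/2] to any average, so
    the part above must have average larger than [lam/2]. *)
Lemma weak_type_truncated : exists N : nat, forall f x r lam,
  measurable_fun setT f -> (0 < lam)%R -> (0 < r)%R ->
  lam%:E * mu (ball x r `&` exceeds beta (abse \o f) lam 0 (2 * r)) <=
  (2 * N%:R)%:E * \int[muT]_(y in ball x (3 * r)%R)
     (if (lam / 2)%:E < `|f y| then `|f y| else 0).
Proof.
have [N wtN] := weak_type dX mmu beta_gt1; exists N.
move=> f x r lam mf lam0 r0.
have maf : measurable_fun setT (abse \o f) by exact: measurableT_comp.
pose g : T -> \bar R := fun y => if (lam / 2)%:E < `|f y| then `|f y| else 0.
have g0 y : 0 <= g y by rewrite /g; case: ifP.
have mg : measurable_fun setT g by exact: measurable_above_level.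
have lam20 : (0 <= lam / 2)%R by rewrite divr_ge0// ltW.
have -> : lam%:E = 2%:E * (lam / 2)%:E by rewrite -EFinM; congr _%:E; field.
rewrite EFinM -!muleA lee_pmul2l// (le_trans _ (wtN g x r _ mg g0 lam20 r0))//.
rewrite lee_pmul2l//; last by rewrite lte_fin divr_gt0.
apply: le_outer_measure => y [xy [s s2 ls]]; split => //; exists s => //.
rewrite ltNge; apply/negP => lg; move: ls; rewrite ltNge => /negP; apply.
have mB := measurable_mball mmu y s.
apply: (@le_trans _ _ (\int[muT]_(z in ball y s) (g z + (lam / 2)%:E))).
  apply: ge0_le_integral => //.
  - by move=> z _; exact: abse_ge0.
  - exact: measurable_funTS.
  - by apply: emeasurable_funD => //; exact: measurable_funTS.
  move=> z _; rewrite /g /=; case: ltP => h; first by rewrite leeDl// lee_fin.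
  by rewrite add0e.
rewrite ge0_integralD//; last exact: measurable_funTS.
have -> : lam%:E = (lam / 2)%:E + (lam / 2)%:E by rewrite -EFinD; congr _%:E; field.
rewrite ge0_muleDl ?lee_fin//; apply: leeD => //.
rewrite integral_cst// lee_pmul2l ?lte_fin ?divr_gt0//; apply: le_outer_measure.
by apply: ball_subset; case/andP: s2 => s0 _; rewrite mdistxx add0r ler_peMl// ltW.
Qed.
End maximal.

Section dyadic_integrals.
Context d (T : measurableType d) (R : realType).
Variables (nu : {measure set T -> \bar R}) (D : set T) (mD : measurable D).
Variables (p c : R) (h : T -> \bar R).
Hypotheses (p_gt1 : (1 < p)%R) (c_gt0 : (0 < c)%R).
Hypotheses (mh : measurable_fun setT h) (h0 : forall y, (0 <= h y)%E).
Local Open Scope ereal_scope.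

Lemma measurable_nneseries (F : nat -> T -> \bar R) :
  (forall j, measurable_fun setT (F j)) -> (forall j y, 0 <= F j y) ->
  measurable_fun D (fun y => \sum_(j <oo) F j y).
Proof.
move=> mF F0; apply: (ge0_emeasurable_sum (P := xpredT)) => // j _.
exact: measurable_funTS.
Qed.

Lemma integral_le_levels :
  \int[nu]_(y in D) (h y `^ p) <= (c `^ p)%:E * nu D +
    \sum_(j <oo) ((c * 2 ^+ j.+1) `^ p)%:E *
      nu (D `&` [set y | (c * 2 ^+ j)%:E < h y]).
Proof.
pose I j y : \bar R := if (c * 2 ^+ j)%:E < h y then 1 else 0.
have mI j : measurable_fun setT (I j).
  by apply: measurable_fun_ifT => //; exact: measurable_fun_lte.
have I0 j y : 0 <= I j y by rewrite /I; case: ifP.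
pose F j y := ((c * 2 ^+ j.+1) `^ p)%:E * I j y.
have mF j : measurable_fun setT (F j) by exact: measurable_funeM.
have F0 j y : 0 <= F j y by rewrite mule_ge0// lee_fin powR_ge0.
apply: (@le_trans _ _ (\int[nu]_(y in D) ((c `^ p)%:E + \sum_(j <oo) F j y))).
  apply: ge0_le_integral => //.
  - by move=> y _; exact: poweR_ge0.
  - apply: measurable_funTS; exact: (measurableT_comp (measurable_poweR p)).
  - by apply: emeasurable_funD => //; exact: measurable_nneseries.
  - by move=> y _; exact: nneseries_levels_above.
rewrite ge0_integralD//; last 3 first.
- by move=> y _; rewrite lee_fin powR_ge0.
- by move=> y _; exact: nneseries_ge0.
- exact: measurable_nneseries.
rewrite integral_cst// leeD2l// integral_nneseries//; last first.
  by move=> j; exact: measurable_funTS.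
apply: lee_nneseries => [j _ _|j _].
  by apply: integral_ge0.
rewrite ge0_integralZl_EFin ?powR_ge0//; last exact: measurable_funTS.
rewrite lee_wpmul2l ?lee_fin ?powR_ge0//.
pose A : set T := [set y | (c * 2 ^+ j)%:E < h y].
rewrite (eq_integral (fun y => (\1_A y : R)%:E)).
  rewrite integral_indic//; first by rewrite setIC.
  rewrite -[A]setTI; exact: emeasurable_fun_o_infty.
move=> y _; rewrite /I indicE.
by case: ifP => ly; [rewrite mem_set|rewrite memNset// /A /= ly].
Qed.

Lemma levels_le_integral :
  \sum_(j <oo) ((c * 2 ^+ j) `^ (p - 1))%:E *
    \int[nu]_(y in D) (if (c * 2 ^+ j / 2)%:E < h y then h y else 0) <=
  (2 `^ (p - 1) / (2 `^ (p - 1) - 1) * 2 `^ (p - 1))%:E *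
    \int[nu]_(y in D) (h y `^ p).
Proof.
pose G j y := if (c * 2 ^+ j / 2)%:E < h y then h y else 0.
have mG j : measurable_fun setT (G j).
  by apply: measurable_fun_ifT => //; exact: measurable_fun_lte.
have G0 j y : 0 <= G j y by rewrite /G; case: ifP.
pose F j y := ((c * 2 ^+ j) `^ (p - 1))%:E * G j y.
have mF j : measurable_fun setT (F j) by exact: measurable_funeM.
have F0 j y : 0 <= F j y by rewrite mule_ge0// lee_fin powR_ge0.
have mhp : measurable_fun D (fun y => h y `^ p).
  by apply: measurable_funTS; exact: (measurableT_comp (measurable_poweR p)).
have w1 := powR2_gt1 p_gt1.
rewrite (eq_eseriesr (g := fun j => \int[nu]_(y in D) F j y)); last first.
  move=> j _; rewrite ge0_integralZl_EFin ?powR_ge0//.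
  exact: measurable_funTS.
rewrite -integral_nneseries//; last by move=> j; exact: measurable_funTS.
rewrite -ge0_integralZl_EFin//; last 2 first.
- by move=> y _; exact: poweR_ge0.
- by rewrite mulr_ge0 ?divr_ge0 ?powR_ge0// subr_ge0 ltW.
apply: ge0_le_integral => //.
- by move=> y _; exact: nneseries_ge0.
- exact: measurable_nneseries.
- exact: measurable_funeM.
- by move=> y _; exact: nneseries_levels_below.
Qed.

End dyadic_integrals.

(** * The local L^p estimate *)

Section local_bound.
Context {R : realType} {X : pmetricType R} {mu : {outer_measure set X -> \bar R}}.
Local Notation T := (caratheodory_type mu).
Local Notation muT := (mu : set T -> \bar R).
Hypotheses (dX : geometrically_doubling X) (mmu : metric_measure mu).
Local Open Scope ereal_scope.
Implicit Types (x y z : X) (r s lam : R) (f : T -> \bar R).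

(** Above the level [c] only radii below [2r] matter, and [weak_type_truncated]
    applies at each level [c 2^j].  The base level [c] need not be small, which
    is why the estimate is stated on a ball of finite measure. *)
Lemma integral_maximal_ball beta p : (1 < beta)%R -> (1 < p)%R ->
  exists2 K : R, (0 <= K)%R & forall f x r (c : R),
  measurable_fun setT f -> (0 < r)%R -> (0 < c)%R ->
  (forall y s, ball x r y -> (2 * r <= s)%R ->
    \int[muT]_(z in ball y s) `|f z| <= c%:E * mu (ball y (beta * s)%R)) ->
  \int[muT]_(y in ball x r) (`|modified_maximal mu beta f y| `^ p) <=
  (c `^ p * vol mu x r)%:E +
  K%:E * \int[muT]_(y in ball x (3 * r)%R) (`|f y| `^ p).
Proof.
move=> b1 p1; have [N wtN] := weak_type_truncated dX mmu b1.
have p0 : (0 < p)%R by rewrite (lt_trans _ p1).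
have w1 := powR2_gt1 p1.
pose W : R := (2 `^ (p - 1) / (2 `^ (p - 1) - 1) * 2 `^ (p - 1))%R.
have W0 : (0 <= W)%R by rewrite mulr_ge0 ?divr_ge0 ?powR_ge0// subr_ge0 ltW.
pose L : R := (2 `^ p * (2 * N%:R))%R.
have L0 : (0 <= L)%R by rewrite mulr_ge0// powR_ge0.
exists (L * W)%R; first exact: mulr_ge0.
move=> f x r c mf r0 c0 fc.
have mM := measurable_maximal mmu b1 mf.
have maf : measurable_fun setT (abse \o f) by exact: measurableT_comp.
have maM : measurable_fun setT (abse \o modified_maximal mu beta f).
  exact: measurableT_comp.
have mB s := measurable_mball mmu x s.
have aM0 y : 0 <= (abse \o modified_maximal mu beta f) y by exact: abse_ge0.
rewrite (le_trans (integral_le_levels muT (mB r) p1 c0 maM aM0))//.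
apply: leeD; first by rewrite EFinM lee_wpmul2l ?lee_fin ?powR_ge0// -(mu_ballE mmu).
rewrite EFinM -muleA.
apply: le_trans; last first.
  apply: lee_wpmul2l; first by rewrite lee_fin.
  apply: (levels_le_integral muT (mB (3 * r)%R) p1 c0 maf).
  by move=> y; exact: abse_ge0.
rewrite -nneseriesZl; last first.
  move=> j _; rewrite mule_ge0 ?lee_fin ?powR_ge0// integral_ge0// => y _.
  by case: ifP => // _; exact: abse_ge0.
apply: lee_nneseries => [j _ _|j _].
  by rewrite mule_ge0 ?lee_fin ?powR_ge0// outer_measure_ge0.
have l0 := level_gt0 c0 j; set l := (c * 2 ^+ j)%R in l0 *.
have -> : ((c * 2 ^+ j.+1) `^ p)%R = (2 `^ p * l `^ (p - 1) * l)%R.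
  rewrite -mulrA (mulrC (l `^ _)%R) (mulr_powRB1 (ltW l0) p0) -powRM ?(ltW l0)//.
  by congr (_ `^ _)%R; rewrite /l exprS; ring.
rewrite [L%:E]EFinM muleACA -EFinM [in leLHS]EFinM -[leLHS]muleA.
apply: lee_wpmul2l; first by rewrite lee_fin mulr_ge0// powR_ge0.
apply: le_trans (wtN f x r l mf l0 r0).
rewrite lee_pmul2l//; apply: le_outer_measure => y [xy /= ly]; split => //.
move: ly; rewrite gee0_abs; last exact: maximal_ge0.
move=> /(maximal_gtP mmu b1 f y (ltW l0))[s s0 ls].
exists s => //; rewrite s0 ltNge; apply/negP => rs.
move: ls; rewrite ltNge (le_trans (fc y s xy rs))// lee_wpmul2r ?lee_fin//.
by rewrite ler_peMr ?(ltW c0)// exprn_ege1// ler1n.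
Qed.

End local_bound.

(** * Morrey bounds *)

(** Solving the inequality between one term of the Morrey supremum and [A] for
    the integral [I]. *)
Lemma le_morrey_term (R : realType) (p q m A : R) (I : \bar R) :
  0 < p -> 0 < m -> 0 <= A -> (0 <= I)%E ->
  (m%:E `^ (q^-1 - p^-1) * I `^ p^-1 <= A%:E)%E =
  (I <= (A `^ p * m `^ (1 - p / q))%:E)%E.
Proof.
move=> p0 m0 A0; have pV0 : p^-1 != 0 by rewrite invr_neq0 ?gt_eqF.
have me : 0 < m `^ (q^-1 - p^-1) by exact: powR_gt0.
case: I => [i|_|//]; last first.
  by rewrite poweRyr// poweR_EFin gt0_muley ?lte_fin// !leye_eq.
rewrite !poweR_EFin -EFinM !lee_fin => i0.
rewrite -ler_pdivlMl// -powRN opprB.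
have -> : A `^ p * m `^ (1 - p / q) = (m `^ (p^-1 - q^-1) * A) `^ p.
  rewrite powRM ?powR_ge0// mulrC -powRrM mulrBl mulVf ?gt_eqF//.
  by rewrite (mulrC p).
set B := _ * A; have B0 : 0 <= B by rewrite mulr_ge0// powR_ge0.
apply/idP/idP => H.
  have : (i `^ p^-1) `^ p <= B `^ p.
    by rewrite ge0_ler_powR ?nnegrE ?powR_ge0// ltW.
  by rewrite -powRrM mulVf ?gt_eqF// powRr1.
have : i `^ p^-1 <= (B `^ p) `^ p^-1.
  by rewrite ge0_ler_powR ?nnegrE ?powR_ge0 ?invr_ge0// ltW.
by rewrite -powRrM mulfV ?gt_eqF// powRr1.
Qed.

Section morrey_bounds.
Context {R : realType} {X : pmetricType R} {mu : {outer_measure set X -> \bar R}}.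
Local Notation T := (caratheodory_type mu).
Local Notation muT := (mu : set T -> \bar R).
Hypotheses (dX : geometrically_doubling X) (mmu : metric_measure mu).
Variables (p q : R).
Hypotheses (p_gt1 : (1 < p)%R) (le_pq : (p <= q)%R).
Local Open Scope ereal_scope.
Implicit Types (x y z : X) (k r s A : R) (f : T -> \bar R).

Let p_gt0 : (0 < p)%R. Proof. by rewrite (lt_trans _ p_gt1). Qed.
Let q_gt0 : (0 < q)%R. Proof. by rewrite (lt_le_trans _ le_pq). Qed.
Let exponent_ge0 : (0 <= 1 - p / q)%R.
Proof. by rewrite subr_ge0 ler_pdivrMr// mul1r. Qed.

(** The Morrey norm is at most [A], with the roots cleared. *)
Definition morrey_bounded k A f := forall x r, (0 < r)%R ->
  \int[muT]_(y in ball x r) (`|f y| `^ p) <=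
  (A `^ p * vol mu x (k * r) `^ (1 - p / q))%:E.

Lemma morrey_norm_leP k A f : (0 < k)%R -> (0 <= A)%R ->
  morrey_norm mu p q k f <= A%:E <-> morrey_bounded k A f.
Proof.
move=> k0 A0.
have termE x r : (0 < r)%R -> (mu (ball x (k * r)%R) `^ (q^-1 - p^-1) *
     (\int[muT]_(y in ball x r) (`|f y| `^ p)) `^ p^-1 <= A%:E) =
   (\int[muT]_(y in ball x r) (`|f y| `^ p) <=
     (A `^ p * vol mu x (k * r) `^ (1 - p / q))%:E).
  move=> r0; rewrite (mu_ballE mmu) le_morrey_term//.
    by apply: vol_gt0 => //; exact: mulr_gt0.
  by apply: integral_ge0 => y _; exact: poweR_ge0.
split=> [fA x r r0|fA].
  rewrite -termE//; apply: le_trans fA; apply: ereal_sup_ubound.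
  by exists (x, r).
by apply: ge_ereal_sup => _ [[x r] /= r0 <-]; rewrite termE//; exact: fA.
Qed.

Lemma measurable_poweR_abs f : measurable_fun setT f ->
  measurable_fun setT ((fun y => `|f y| `^ p) : T -> \bar R).
Proof.
move=> mf; apply: (measurableT_comp (measurable_poweR p)).
exact: measurableT_comp.
Qed.

(** Cover [B(x,r)] by balls [B(z, e r)] with [z] in [B(x,r)]; [e] is such that
    [r + k2 e r = k1 r], so that [B(z, k2 e r)] lies in [B(x, k1 r)].  The
    exponent [1 - p/q] is nonnegative, so the bound for the small balls is at
    most the one sought for the large ball. *)
Lemma morrey_bounded_change (k1 k2 : R) : (1 < k1)%R -> (0 < k2)%R ->
  exists2 D : R, (0 < D)%R & forall A f, (0 <= A)%R -> measurable_fun setT f ->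
    morrey_bounded k2 A f -> morrey_bounded k1 (D * A) f.
Proof.
move=> k11 k20; pose e : R := ((k1 - 1) / k2)%R.
have e0 : (0 < e)%R by rewrite divr_gt0// subr_gt0.
have [N dN] := doubling_cover dX e0.
exists (N.+1%:R `^ p^-1)%R; first exact: powR_gt0.
move=> A f A0 mf fA x r r0.
have mfp := measurable_poweR_abs mf.
have [u [uN ux uc]] := dN x r _ r0 (@subset_refl _ (ball x r)).
pose g y := `|f y| `^ p; have g0 y : 0 <= g y by exact: poweR_ge0.
have er0 : (0 < e * r)%R by exact: mulr_gt0.
have mB y s := measurable_mball mmu y s.
apply: (@le_trans _ _ (\sum_(z <- u) \int[muT]_(y in ball z (e * r)) g y)).
  under eq_bigr do rewrite integral_mkcond.
  have mgB z : measurable_fun setT (g \_ (ball z (e * r)%R : set T)).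
    by apply/measurable_restrict => //; exact: measurable_funTS.
  have gB0 z y : 0 <= (g \_ (ball z (e * r)%R : set T)) y.
    by rewrite patchE; case: ifP.
  rewrite -(ge0_integral_sum muT)// [leLHS]integral_mkcond; apply: ge0_le_integral => //.
  - by move=> y _; rewrite patchE; case: ifP => // _; exact: poweR_ge0.
  - by apply/measurable_restrict => //; exact: measurable_funTS.
  - exact: emeasurable_sum.
  move=> y _; rewrite [leLHS]patchE; case: ifPn => [|_]; last exact: sume_ge0.
  rewrite inE => /uc[z zu zy].
  rewrite (perm_big _ (perm_to_rem zu)) big_cons/=.
  rewrite (@le_trans _ _ ((g \_ (ball z (e * r)%R : set T)) y))//; last first.
    by rewrite leeDl// sume_ge0.
  by rewrite patchE mem_set//; exact/in_ball.
apply: (@le_trans _ _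
    (\sum_(z <- u) (A `^ p * vol mu x (k1 * r) `^ (1 - p / q))%:E)).
  rewrite big_seq [leRHS]big_seq; apply: lee_sum => z zu.
  rewrite (le_trans (fA z _ er0))// lee_fin ler_wpM2l ?powR_ge0//.
  apply: ge0_ler_powR => //; rewrite ?nnegrE; [exact: fine_ge0..|].
  apply: (vol_le mmu); apply: ball_subset.
  have /in_ball xz := ux z zu.
  have -> : (k2 * (e * r) = (k1 - 1) * r)%R by rewrite /e; field; rewrite gt_eqF.
  lra.
rewrite sumEFin lee_fin big_const_seq count_predT iter_addr_0.
rewrite powRM ?powR_ge0// -powRrM mulVf ?gt_eqF// powRr1// -mulrA -[leLHS]mulr_natl.
by rewrite ler_wpM2r ?mulr_ge0 ?powR_ge0// ler_nat leqW.
Qed.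

(** Integrate [a <= t + t^(1-p) a^p], which holds for every [a >= 0]; both terms
    are bounded by [t v].  This replaces Hoelder's inequality. *)
Lemma integral_le_of_power (E : set T) f (t v : R) : measurable E ->
  measurable_fun setT f -> (0 < t)%R -> mu E <= v%:E ->
  \int[muT]_(y in E) (`|f y| `^ p) <= (t `^ p * v)%:E ->
  \int[muT]_(y in E) `|f y| <= (2 * t * v)%:E.
Proof.
move=> mE mf t0 Ev fv; have mfp := measurable_poweR_abs mf.
have maf : measurable_fun E (abse \o f).
  by apply: measurable_funTS; exact: measurableT_comp.
have tp0 : (0 <= t `^ (1 - p))%R by exact: powR_ge0.
apply: (@le_trans _ _
    (\int[muT]_(y in E) (t%:E + (t `^ (1 - p))%:E * (`|f y| `^ p)))).
  have mR : measurable_fun E (fun y => (t `^ (1 - p))%:E * (`|f y| `^ p)).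
    by apply: measurable_funeM; exact: measurable_funTS.
  apply: ge0_le_integral => //.
    exact: emeasurable_funD.
  move=> y _; case: (f y) => [a| |]/=; last 2 first.
  - by rewrite gt_eqF// gt0_muley ?leey// lte_fin powR_gt0.
  - by rewrite gt_eqF// gt0_muley ?leey// lte_fin powR_gt0.
  rewrite -EFinM -EFinD lee_fin; set b := `|a|%R.
  have b0 : (0 <= b)%R by exact: normr_ge0.
  have [bt|tb] := leP b t.
    by rewrite (le_trans bt)// lerDl mulr_ge0// powR_ge0.
  rewrite (@le_trans _ _ (t `^ (1 - p) * b `^ p)%R)//; last by rewrite lerDr ltW.
  rewrite -(mulr_powRB1 b0 p_gt0) mulrCA ler_peMr// -opprB powRN mulrC.
  rewrite ler_pdivlMr ?powR_gt0// mul1r ge0_ler_powR ?nnegrE// ?subr_ge0 ltW//.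
rewrite ge0_integralD//; last 3 first.
- by move=> y _; rewrite lee_fin ltW.
- by move=> y _; rewrite mule_ge0 ?lee_fin// poweR_ge0.
- by apply: measurable_funeM; exact: measurable_funTS.
rewrite integral_cst// ge0_integralZl_EFin//; last 2 first.
- by move=> y _; exact: poweR_ge0.
- exact: measurable_funTS.
have -> : (2 * t * v)%:E = t%:E * v%:E + (t `^ (1 - p))%:E * (t `^ p * v)%:E.
  rewrite -!EFinM -EFinD mulrA -powRD; last by rewrite subrK oner_eq0.
  by rewrite subrK powRr1 ?(ltW t0)//; congr _%:E; ring.
by apply: leeD; apply: lee_wpmul2l => //; rewrite lee_fin// ltW.
Qed.

(** The parameter [3k] appears because the local estimate on [B(x,r)] involves
    [f] on [B(x,3r)], and [A > 0] because the base level [c] of the dyadic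
    decomposition must be positive. *)
Lemma morrey_bounded_maximal beta k : (1 < beta)%R -> (1 < k)%R ->
  exists2 C : R, (0 < C)%R & forall A f, (0 < A)%R -> measurable_fun setT f ->
    morrey_bounded k A f ->
    morrey_bounded (3 * k) (C * A) (modified_maximal mu beta f).
Proof.
move=> b1 k1; have k0 : (0 < k)%R by rewrite (lt_trans _ k1).
have b0 : (0 < beta)%R by rewrite (lt_trans _ b1).
have [D D0 chg] := morrey_bounded_change b1 k0.
have [K K0 locK] := integral_maximal_ball dX mmu b1 p_gt1.
pose C : R := (((2 * D) `^ p + K) `^ p^-1)%R.
have C0 : (0 < (2 * D) `^ p + K)%R by rewrite ltr_pwDl// powR_gt0// mulr_gt0.
exists C; first exact: powR_gt0.
move=> A f A0 mf fA x r r0.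
have fDA := chg A f (ltW A0) mf fA.
have DA0 : (0 < D * A)%R by exact: mulr_gt0.
have m0 : (0 < vol mu x r)%R by exact: vol_gt0.
set m := vol mu x r in m0.
(* Bound for the averages over radii [s >= 2r]; see [integral_le_of_power] for
   the factor 2. *)
pose c : R := (2 * (D * A * m `^ (- q^-1)))%R.
have c0 : (0 < c)%R by rewrite !mulr_gt0// powR_gt0.
apply: le_trans (locK f x r c mf r0 c0 _) _.
  move=> y s /in_ball xy rs.
  have s0 : (0 < s)%R by rewrite (lt_le_trans _ rs)// mulr_gt0.
  have v0 : (0 < vol mu y (beta * s))%R by apply: vol_gt0 => //; exact: mulr_gt0.
  pose t : R := (D * A * vol mu y (beta * s) `^ (- q^-1))%R.
  have t0 : (0 < t)%R by rewrite mulr_gt0// powR_gt0.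
  rewrite (mu_ballE mmu) -EFinM.
  apply: (@le_trans _ _ (2 * t * vol mu y (beta * s))%:E).
    apply: integral_le_of_power => //; first exact: (measurable_mball mmu).
      rewrite -(mu_ballE mmu); apply: le_outer_measure; apply: ball_subset.
      by rewrite mdistxx add0r ler_peMl// ltW.
    rewrite (le_trans (fDA y s s0))// lee_fin /t.
    rewrite (@powRM _ (D * A)%R) ?powR_ge0 ?(ltW DA0)//.
    rewrite -mulrA -powRrM -{3}[vol mu y _](powRr1 (ltW v0)) -powRD.
      by rewrite addrC mulNr (mulrC _ p).
    by rewrite (gt_eqF v0) implybT.
  rewrite lee_fin ler_wpM2r ?(ltW v0)// ler_wpM2l// ler_wpM2l ?(ltW DA0)//.
  rewrite !powRN lef_pV2 ?posrE ?powR_gt0// ge0_ler_powR ?nnegrE ?invr_ge0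
    ?(ltW m0, ltW v0, ltW q_gt0)//.
  apply: (vol_le mmu); apply: ball_subset; rewrite metric_sym.
  have : (s <= beta * s)%R by rewrite ler_peMl// ltW.
  lra.
have r30 : (0 < 3 * r)%R by exact: mulr_gt0.
have rE : (k * (3 * r) = 3 * k * r)%R by ring.
have := fA x _ r30; rewrite rE; set V := vol mu x _ => fV.
have mV : (m `^ (1 - p / q) <= V `^ (1 - p / q))%R.
  apply: ge0_ler_powR => //; rewrite ?nnegrE; [exact: fine_ge0..|].
  apply: (vol_le mmu); apply: ball_subset; rewrite mdistxx add0r ler_peMl//;
    lra.
apply: (@le_trans _ _ (((2 * D) `^ p * A `^ p * V `^ (1 - p / q))%:E +
   K%:E * (A `^ p * V `^ (1 - p / q))%:E)); last first.
  rewrite -EFinM -EFinD lee_fin (@powRM _ C) ?powR_ge0 ?(ltW A0)//.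
  rewrite -powRrM mulVf ?gt_eqF// powRr1 ?(ltW C0)// le_eqVlt.
  by apply/orP; left; apply/eqP; ring.
apply: leeD; last by apply: lee_wpmul2l; rewrite ?lee_fin.
rewrite lee_fin -/m; apply: le_trans (ler_wpM2l _ mV); last first.
  by rewrite mulr_ge0// powR_ge0.
rewrite /c !mulrA powRM ?powR_ge0//; last by rewrite !mulr_ge0// ltW.
rewrite (@powRM _ _ A) ?mulr_ge0 ?(ltW A0, ltW D0)// -mulrA.
rewrite ler_wpM2l ?mulr_ge0 ?powR_ge0//.
rewrite -powRrM -{2}[m](powRr1 (ltW m0)) -powRD ?(gt_eqF m0) ?implybT//.
by rewrite addrC mulNr (mulrC _ p).
Qed.

End morrey_bounds.

Lemma morrey_norm_ge0 (R : realType) (X : pmetricType R)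
    (mu : {outer_measure set X -> \bar R}) (p q k : R)
    (f : caratheodory_type mu -> \bar R) : (0 <= morrey_norm mu p q k f)%E.
Proof.
apply: le_ereal_sup_tmp; eexists.
  by exists (point, 1) => /=; [exact: ltr01|reflexivity].
by rewrite mule_ge0// poweR_ge0.
Qed.

Theorem theorem5p8 (R : realType) (X : pmetricType R)
    (mu : {outer_measure set X -> \bar R}) (p q beta k : R)
    (doublingX : geometrically_doubling X) (mm_mu : metric_measure mu)
    (p_gt1 : 1 < p) (le_pq : p <= q) (beta_gt1 : 1 < beta) (k_gt1 : 1 < k) :
  exists2 C : R, 0 < C &
    forall f : caratheodory_type mu -> \bar R, morrey_space mu p q k f ->
      morrey_space mu p q k (modified_maximal mu beta f) /\
      (morrey_norm mu p q k (modified_maximal mu beta f)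
         <= C%:E * morrey_norm mu p q k f)%E.
Proof.
have k0 : 0 < k by rewrite (lt_trans _ k_gt1).
have k30 : 0 < 3 * k by exact: mulr_gt0.
have [C C0 maxC] :=
  morrey_bounded_maximal doublingX mm_mu p_gt1 le_pq beta_gt1 k_gt1.
have [D D0 chg] := morrey_bounded_change doublingX mm_mu p_gt1 le_pq k_gt1 k30.
have DC0 : 0 < D * C by exact: mulr_gt0.
exists (D * C) => // f [[mf _] f_fin].
have mM := measurable_maximal mm_mu beta_gt1 mf.
have f_ge0 := morrey_norm_ge0 p q k f.
have bM A : 0 < A -> (morrey_norm mu p q k f <= A%:E)%E ->
    morrey_bounded p q k (D * C * A) (modified_maximal mu beta f).
  move=> A0 /(morrey_norm_leP mm_mu q p_gt1 f k0 (ltW A0)) fA.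
  rewrite -mulrA; apply: chg => //; first by rewrite mulr_ge0// ltW.
  exact: maxC.
have normM : (morrey_norm mu p q k (modified_maximal mu beta f)
    <= (D * C)%:E * morrey_norm mu p q k f)%E.
  move: f_ge0 f_fin bM; case: (morrey_norm mu p q k f) => // a.
  rewrite lee_fin => a0 _ bM.
  (* [bM] is stated for positive constants only, while the norm may vanish. *)
  apply/lee_addgt0Pr => e e0; rewrite -EFinM -EFinD.
  have A0 : 0 < a + e / (D * C) by rewrite ltr_wpDl// divr_gt0.
  have -> : D * C * a + e = D * C * (a + e / (D * C)).
    by rewrite mulrDr (mulrC e) mulVKf ?gt_eqF.
  apply/(morrey_norm_leP mm_mu q p_gt1 _ k0).
    by rewrite mulr_ge0// ltW.
  by apply: bM => //; rewrite lee_fin lerDl divr_ge0// ltW.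
split=> //; split; last first.
  by rewrite (le_lt_trans normM)// lte_mul_pinfty// ?lee_fin ltW.
split=> // x; exists 1 => //.
have := bM (fine (morrey_norm mu p q k f) + 1).
have fA : (morrey_norm mu p q k f <= (fine (morrey_norm mu p q k f) + 1)%:E)%E.
  by rewrite EFinD fineK ?leeDl// ge0_fin_numE.
move=> /(_ _ fA)/(_ x 1 ltr01) H; apply: le_lt_trans (H _) (ltry _).
by rewrite ltr_wpDl// fine_ge0.
Qed.
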